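(* Let $k\ge2$ and let $(\mathscr V,\mathbf c,\boldsymbol\mu)$ be an entropy system satisfying the entropy condition, where $\mathscr V=(V_0,\ldots,V_r)$, $\mathbf c=(c_1,\ldots,c_{r+1})$, $c_1=1$ and $b=c_{r+1}>0$. Then, for every $c^\ast\in(0,b)$, there exist a complete flag $$\mathscr W:\quad V_0=W_0<W_1<\cdots<W_h=V_r$$ with $\{V_0,\ldots,V_r\}\subseteq\{W_0,\ldots,W_h\}$, a threshold sequence $\widetilde{\mathbf c}=(\widetilde c_1,\ldots,\widetilde c_{h+1})$, and a family of probability measures $\widetilde{\boldsymbol\mu}=(\widetilde\mu_1,\ldots,\widetilde\mu_h)$ such that $\widetilde c_1=1$, $\widetilde c_{h+1}=c^\ast$, and $(\mathscr W,\widetilde{\mathbf c},\widetilde{\boldsymbol\mu})$ is an entropy system satisfying the strict entropy condition.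
   Context: Vector spaces are over $\mathbb Q$; $\mathbf 1=(1,\dots,1)\in\mathbb Q^k$; $\{0,1\}^k\subset\mathbb Q^k$; logarithms are natural and $0\log0=0$. $U\le V$ means $U$ is a subspace of $V$, and $U<V$ a proper subspace. An entropy system is a triple $(\mathscr V,\mathbf c,\boldsymbol\mu)$ with $\mathscr V=(V_0,\dots,V_r)$, $\mathbf c=(c_1,\dots,c_{r+1})$, $\boldsymbol\mu=(\mu_1,\dots,\mu_r)$ such that: (a) $\langle\mathbf 1\rangle=V_0<V_1<\cdots<V_r\le\mathbb Q^k$ and each $V_j$ is spanned by points of $\{0,1\}^k$; (b) $V_r$ is non-degenerate: for all $1\le s<t\le k$ there is $x\in V_r$ with $x_s\ne x_t$; (c) $1\ge c_1\ge c_2\ge\cdots\ge c_{r+1}\ge0$ (the threshold sequence); (d) each $\mu_j$ is a probability measure on $V_j\cap\{0,1\}^k$ (extended by zero). A flag $(V_0,\dots,V_r)$ is complete if $\dim(V_j/V_{j-1})=1$ for $1\le j\le r$. For a finitely supported probability measure $\mu$ on $\mathbb Q^k$ and $W\le\mathbb Q^k$, put $\mu(W+x)=\sum_{y\in W+x}\mu(y)$ and $\mathbb H_\mu(W)=-\sum_x\mu(x)\log\mu(W+x)$. A subflag $\mathscr V'\le\mathscr V$ is a sequence $\langle\mathbf 1\rangle=V_0'\le V_1'\le\cdots\le V_r'$ of subspaces with $V_j'\le V_j$ for all $j$; it is proper, written $\mathscr V'<\mathscr V$, if $V_j'<V_j$ for at least one $1\le j\le r$. Put $$\mathrm e(\mathscr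 V',\mathbf c,\boldsymbol\mu)=\sum_{j=1}^r(c_j-c_{j+1})\mathbb H_{\mu_j}(V_j')+\sum_{j=1}^rc_j\dim(V_j'/V_{j-1}').$$ The system satisfies the entropy condition if $\mathrm e(\mathscr V',\mathbf c,\boldsymbol\mu)\ge\mathrm e(\mathscr V,\mathbf c,\boldsymbol\mu)$ for all $\mathscr V'\le\mathscr V$, and the strict entropy condition if $\mathrm e(\mathscr V',\mathbf c,\boldsymbol\mu)>\mathrm e(\mathscr V,\mathbf c,\boldsymbol\mu)$ for all $\mathscr V'<\mathscr V$. *)

(* Defs.v *)
From HB Require Import structures.
From mathcomp Require Import all_boot all_order all_algebra.
From mathcomp Require Import finmap.
From mathcomp Require Import reals exp.

Set Implicit Arguments.
Unset Strict Implicit.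
Unset Printing Implicit Defensive.

Import Order.TTheory GRing.Theory Num.Theory.

Local Open Scope ring_scope.

(** Sequences [V], [c], [mu] are functions on [nat], with the indices of the
    mathematical text; only [V 0 .. V r], [c 1 .. c r.+1] and [mu 1 .. mu r]
    are ever constrained or used, the other values are irrelevant. *)

Definition is_cube (k : nat) (x : 'rV[rat]_k) : bool :=
  [forall i, (x 0 i == 0) || (x 0 i == 1)].

Definition ones_line (k : nat) : {vspace 'rV[rat]_k} :=
  <[const_mx 1]>%VS.

Definition proper_subv (k : nat) (U V : {vspace 'rV[rat]_k}) : bool :=
  (U <= V)%VS && (U != V).

Definition cube_spanned (k : nat) (V : {vspace 'rV[rat]_k}) : Prop :=
  exists2 s : seq 'rV[rat]_k, all (@is_cube k) s & <<s>>%VS = V.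

Definition nondegenerate (k : nat) (V : {vspace 'rV[rat]_k}) : Prop :=
  forall s t : 'I_k, (s < t)%N -> exists2 x, x \in V & x 0 s != x 0 t.

(** [\dim (V / U)]; truncation is harmless as it is used only for [U <= V]. *)
Definition codimv (k : nat) (V U : {vspace 'rV[rat]_k}) : nat :=
  (\dim V - \dim U)%N.

Definition is_flag (k r : nat) (V : nat -> {vspace 'rV[rat]_k}) : Prop :=
  V 0%N = ones_line k /\
  (forall j, (1 <= j <= r)%N -> proper_subv (V j.-1) (V j)).

Definition complete_flag (k r : nat) (V : nat -> {vspace 'rV[rat]_k}) : Prop :=
  is_flag r V /\
  (forall j, (1 <= j <= r)%N -> codimv (V j) (V j.-1) = 1%N).

Definition threshold_sequence (R : realType) (r : nat) (c : nat -> R) : Prop :=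
  [/\ c 1%N <= 1,
      forall j, (1 <= j <= r)%N -> c j.+1 <= c j
    & 0 <= c r.+1].

(** Finitely supported real functions on [Q^k]. *)
Definition fsmeas (R : realType) (k : nat) := {fsfun 'rV[rat]_k -> R with 0}.

Definition is_probability (R : realType) (k : nat) (mu : fsmeas R k) : Prop :=
  (forall x, 0 <= mu x) /\ \sum_(x <- finsupp mu) mu x = 1.

Definition supported_on_cube (R : realType) (k : nat) (mu : fsmeas R k)
    (V : {vspace 'rV[rat]_k}) : Prop :=
  forall x, mu x != 0 -> x \in V /\ is_cube x.

(** [mu (W + x)] *)
Definition coset_mass (R : realType) (k : nat) (mu : fsmeas R k)
    (W : {vspace 'rV[rat]_k}) (x : 'rV[rat]_k) : R :=
  \sum_(y <- finsupp mu | y - x \in W) mu y.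

Definition entropy (R : realType) (k : nat) (mu : fsmeas R k)
    (W : {vspace 'rV[rat]_k}) : R :=
  - \sum_(x <- finsupp mu) mu x * ln (coset_mass mu W x).

Definition entropy_system (R : realType) (k r : nat)
    (V : nat -> {vspace 'rV[rat]_k}) (c : nat -> R)
    (mu : nat -> fsmeas R k) : Prop :=
  [/\ is_flag r V /\ (forall j, (j <= r)%N -> cube_spanned (V j)),
      nondegenerate (V r),
      threshold_sequence r c
    & forall j, (1 <= j <= r)%N ->
        is_probability (mu j) /\ supported_on_cube (mu j) (V j)].

Definition subflag (k r : nat) (V' V : nat -> {vspace 'rV[rat]_k}) : Prop :=
  [/\ V' 0%N = ones_line k,
      forall j, (1 <= j <= r)%N -> (V' j.-1 <= V' j)%VS
    & forall j, (j <= r)%N -> (V' j <= V j)%VS].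

Definition proper_subflag (k r : nat) (V' V : nat -> {vspace 'rV[rat]_k}) :
    Prop :=
  subflag r V' V /\ (exists2 j, (1 <= j <= r)%N & proper_subv (V' j) (V j)).

Definition evalue (R : realType) (k r : nat) (V' : nat -> {vspace 'rV[rat]_k})
    (c : nat -> R) (mu : nat -> fsmeas R k) : R :=
  \sum_(1 <= j < r.+1) (c j - c j.+1) * entropy (mu j) (V' j)
  + \sum_(1 <= j < r.+1) c j * (codimv (V' j) (V' j.-1))%:R.

Definition entropy_condition (R : realType) (k r : nat)
    (V : nat -> {vspace 'rV[rat]_k}) (c : nat -> R)
    (mu : nat -> fsmeas R k) : Prop :=
  forall V', subflag r V' V -> evalue r V' c mu >= evalue r V c mu.

Definition strict_entropy_condition (R : realType) (k r : nat)
    (V : nat -> {vspace 'rV[rat]_k}) (c : nat -> R)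
    (mu : nat -> fsmeas R k) : Prop :=
  forall V', proper_subflag r V' V -> evalue r V' c mu > evalue r V c mu.

(* Main.v *)
Require Import Defs.
From HB Require Import structures.
From mathcomp Require Import all_boot all_order all_algebra.
From mathcomp Require Import finmap.
From mathcomp Require Import boolp reals exp.
From mathcomp Require Import ring lra zify.

Set Implicit Arguments.
Unset Strict Implicit.
Unset Printing Implicit Defensive.

Import Order.TTheory GRing.Theory Num.Theory.

Local Open Scope ring_scope.

(** Write [w_j = c_j - c_(j+1)]. Summing by parts ([evalueE]) turns
    [e(V', c, mu)] into
    [\sum_j w_j (H_(mu_j)(V'_j) + dim V'_j) + c_(r+1) dim V'_r]
    up to a constant, which shows how [e] responds to changes of the weights
    and of the measures.

    If two consecutive thresholds agree, the weight between them is zero, and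
    the corresponding space and measure do not enter [e] at all. Hence a flag
    can be refined, one cube-spanned space at a time, by repeating a threshold,
    without changing the values of [e] or the entropy condition
    ([refinement_step], [complete_refinement]). So the flag may be taken to be
    complete.

    For a complete flag, lower [c_(r+1)] from [b] to [c*] and distribute the
    amount [b - c*] gained over the weights, replacing [w_j] by [w_j + d_j]
    with [d_j > 0], and [mu_j] by the average of [mu_j] and [nu_j] with
    weights [w_j] and [d_j]. Entropy is concave in the measure
    ([entropy_concave]), so the entropy condition yields
    [e_new(V') - e_new(V) >= \sum_j d_j (H_(nu_j)(V'_j) - dim (V_j / V'_j))].
    Take a cube point [x] in [V_j] outside [V_(j-1)]: since the all-ones vector
    lies in [V_(j-1)], the cube points [0], [x], [1 - x] lie in three distinct
    cosets of [V_(j-1)] in [V_j]. With [nu_j] uniform on them,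
    [H_(nu_j)(V_(j-1)) = ln 3 > 1] ([ternary_measure], [ln3_gt1]).
    Let [i] be the first index with [V'_i <> V_i]. Then
    [V_(i-1) = V'_(i-1) <= V'_i < V_i], so [V'_i = V_(i-1)] by
    completeness; the terms before [i] vanish, the [i]-th is
    [d_i (ln 3 - 1) > 0], and each later one is at least [- d_j dim V_r]. If
    the [d_j] decrease geometrically with a small enough ratio, the [i]-th
    term wins ([geometric_dominance], [strict_perturbation]). *)

(** * Entropy of measures modulo a subspace *)

Section Entropy.
Local Open Scope fset_scope.
Local Open Scope ring_scope.
Variables (R : realType) (k : nat).
Implicit Types (mu nu : fsmeas R k) (W V : {vspace 'rV[rat]_k}).

(** Sums over different supports can only be combined over a common finite
    set; this and the next few lemmas move them there. *)
Lemma sum_finsupp_widen mu (S : {fset 'rV[rat]_k}) (f : 'rV[rat]_k -> R) :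
  finsupp mu `<=` S ->
  \sum_(x <- finsupp mu) mu x * f x = \sum_(x <- S) mu x * f x.
Proof.
move=> sub; apply: big_fset_incl => // x _ xn.
by rewrite fsfun_dflt ?mul0r.
Qed.

Lemma coset_massE mu (S : {fset 'rV[rat]_k}) W x : finsupp mu `<=` S ->
  coset_mass mu W x = \sum_(y <- S) mu y * (y - x \in W)%:R.
Proof.
move=> sub; rewrite -(sum_finsupp_widen _ sub) /coset_mass big_mkcond /=.
by apply: eq_bigr => y _; case: ifP; rewrite ?mulr1 ?mulr0.
Qed.

Lemma sum_prob mu (S : {fset 'rV[rat]_k}) : is_probability mu ->
  finsupp mu `<=` S -> \sum_(x <- S) mu x = 1.
Proof.
case=> _ <- sub; symmetry; apply: big_fset_incl => // x _ xn.
by rewrite fsfun_dflt.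
Qed.

Lemma coset_mass_eq mu W x y : x - y \in W -> coset_mass mu W x = coset_mass mu W y.
Proof.
move=> xy; apply: eq_bigl => z.
by rewrite -[z - y](subrKA x) [RHS]rpredDr.
Qed.

Lemma coset_mass_ge mu W x : is_probability mu -> mu x <= coset_mass mu W x.
Proof.
case=> mu0 _; have [xS|/fsfun_dflt ->] := boolP (x \in finsupp mu); last first.
  exact: sumr_ge0.
rewrite /coset_mass big_mkcond (big_fsetD1 x) //= subrr mem0v lerDl.
by apply: sumr_ge0 => y _; case: ifP.
Qed.

Lemma coset_mass_le1 mu W x : is_probability mu -> coset_mass mu W x <= 1.
Proof.
case=> mu0 <-; rewrite /coset_mass big_mkcond /=.
by apply: ler_sum => y _; case: ifP.
Qed.

Lemma entropyE mu (S : {fset 'rV[rat]_k}) W : finsupp mu `<=` S ->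
  entropy mu W = - \sum_(x <- S) mu x * ln (coset_mass mu W x).
Proof. by move=> sub; rewrite /entropy (sum_finsupp_widen _ sub). Qed.

Lemma entropy_ge0 mu W : is_probability mu -> 0 <= entropy mu W.
Proof.
move=> pmu; rewrite oppr_ge0; apply: sumr_le0 => x _.
by apply: mulr_ge0_le0; [case: pmu|exact/ln_le0/coset_mass_le1].
Qed.

Lemma entropy_eq0 mu W : is_probability mu ->
  (forall x, mu x != 0 -> x \in W) -> entropy mu W = 0.
Proof.
move=> [_ pmu] muW; rewrite /entropy big_seq big1 ?oppr0// => x.
rewrite mem_finsupp => /muW xW; rewrite /coset_mass big_seq_cond.
rewrite (eq_bigl (fun y => y \in finsupp mu)) -?big_seq ?pmu ?ln1 ?mulr0//.
move=> y; rewrite mem_finsupp; case: eqP => //= /eqP/muW yW.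
by rewrite rpredB.
Qed.

(** Gibbs' inequality for the distributions induced on the cosets of [W]:
    since [ln t <= t - 1], the difference of the two sides is at most
    [\sum_x mu x * nu (W + x) / mu (W + x) - 1], and exchanging the sums shows
    that the first term is the [nu]-mass of the cosets charged by [mu], hence
    at most [1]. *)
Lemma gibbs_cosets mu nu (S : {fset 'rV[rat]_k}) W :
  is_probability mu -> is_probability nu ->
  finsupp mu `<=` S -> finsupp nu `<=` S ->
  (forall x, mu x != 0 -> 0 < coset_mass nu W x) ->
  \sum_(x <- S) mu x * ln (coset_mass nu W x) <=
  \sum_(x <- S) mu x * ln (coset_mass mu W x).
Proof.
move=> pmu pnu smu snu nupos.
have mu0 x : 0 <= mu x by case: pmu.
have nu0 x : 0 <= nu x by case: pnu.
pose p := coset_mass mu W; pose q := coset_mass nu W.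
have p0 x : 0 <= p x by exact: sumr_ge0.
rewrite -/p -/q.
suff: \sum_(x <- S) mu x * (q x / p x) <= 1.
  rewrite -subr_ge0 => le1; rewrite -subr_ge0 -sumrB; apply: (le_trans le1).
  rewrite -(sum_prob pmu smu) -sumrB; apply: ler_sum => x _.
  rewrite -[X in X - _]mulr1 -!mulrBr; have [->|mx] := eqVneq (mu x) 0.
    by rewrite !mul0r.
  apply: ler_wpM2l => //; have qx : 0 < q x by exact: nupos.
  have px : 0 < p x by rewrite (lt_le_trans _ (coset_mass_ge _ _ pmu)) // lt_def mx mu0.
  have : ln (1 + (q x / p x - 1)) <= q x / p x - 1.
    by apply: le_ln1Dx; rewrite ltrBrDr addrC subrr divr_gt0.
  by rewrite addrC subrK ln_div ?posrE // -/(q x); lra.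
rewrite (eq_bigr (fun x => \sum_(y <- S) nu y * (mu x * (x - y \in W)%:R / p y))).
  rewrite exchange_big /= -[leRHS](sum_prob pnu snu); apply: ler_sum => y _.
  rewrite -mulr_sumr -mulr_suml -(coset_massE _ _ smu) -/(p y).
  rewrite ler_piMr //; have [->|py] := eqVneq (p y) 0; first by rewrite mul0r.
  by rewrite divff.
move=> x _; rewrite /q (coset_massE _ _ snu) mulr_suml mulr_sumr.
apply: eq_bigr => y _; rewrite -[x - y]opprB rpredN.
case: (boolP (y - x \in W)) => [yx|]; last by rewrite !(mulr0,mul0r).
by rewrite /p (coset_mass_eq _ yx) !mulr1 mulrCA mulrA.
Qed.

Definition mix (t : R) mu nu : fsmeas R k :=
  [fsfun x in finsupp mu `|` finsupp nu => t * mu x + (1 - t) * nu x].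

Lemma mixE t mu nu x : mix t mu nu x = t * mu x + (1 - t) * nu x.
Proof.
rewrite fsfun_fun in_fsetU; have [xm|] //= := finsuppP mu x.
by have [xn|] //= := finsuppP nu x; rewrite !mulr0 addr0.
Qed.

Lemma finsupp_mix t mu nu : finsupp (mix t mu nu) `<=` finsupp mu `|` finsupp nu.
Proof. exact: finsupp_sub. Qed.

Lemma mix_prob t mu nu : 0 <= t <= 1 -> is_probability mu -> is_probability nu ->
  is_probability (mix t mu nu).
Proof.
move=> /andP[t0 t1] pmu pnu; split=> [x|].
  by rewrite mixE addr_ge0 // mulr_ge0 // ?subr_ge0 //; [case: pmu|case: pnu].
rewrite (big_fset_incl _ (finsupp_mix t mu nu)) /=; last first.
  by move=> x _ xn; rewrite fsfun_dflt.
under eq_bigr do rewrite mixE.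
rewrite big_split /= -!mulr_sumr !sum_prob ?fsubsetUl ?fsubsetUr //; lra.
Qed.

Lemma mix_supported t mu nu V : supported_on_cube mu V -> supported_on_cube nu V ->
  supported_on_cube (mix t mu nu) V.
Proof.
move=> smu snu x; rewrite mixE.
have [m0|/smu//] := eqVneq (mu x) 0; have [n0|/snu//] := eqVneq (nu x) 0.
by rewrite m0 n0 !mulr0 addr0 eqxx.
Qed.

(** The entropy of the mixture is the average of the cross entropies of [mu] and
    [nu] against it, and each of these is bounded below by [gibbs_cosets]. *)
Lemma entropy_concave t mu nu W : 0 <= t <= 1 ->
  is_probability mu -> is_probability nu ->
  t * entropy mu W + (1 - t) * entropy nu W <= entropy (mix t mu nu) W.
Proof.
move=> t01 pmu pnu; have pm := mix_prob t01 pmu pnu.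
have /andP[t0 t1] := t01.
have smu := fsubsetUl (finsupp mu) (finsupp nu).
have snu := fsubsetUr (finsupp mu) (finsupp nu).
have sm := finsupp_mix t mu nu.
rewrite !(entropyE _ smu, entropyE _ snu, entropyE _ sm) !mulrN -opprD lerN2.
under eq_bigr do rewrite mixE mulrDl -!mulrA.
rewrite big_split /= -!mulr_sumr; apply: lerD.
  have [->|tn0] := eqVneq t 0; first by rewrite !mul0r.
  apply: ler_wpM2l => //; apply: gibbs_cosets => // x mx.
  apply: lt_le_trans (coset_mass_ge _ _ pm).
  rewrite mixE ltr_pwDl // ?mulr_ge0 ?subr_ge0 //; last by case: pnu.
  by rewrite mulr_gt0 // lt_def ?tn0 ?mx //=; case: pmu.
have [->|tn0] := eqVneq t 1; first by rewrite subrr !mul0r.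
apply: ler_wpM2l; first by rewrite subr_ge0.
apply: gibbs_cosets => // x mx.
apply: lt_le_trans (coset_mass_ge _ _ pm).
rewrite mixE ltr_wpDl // ?mulr_ge0 //; first by case: pmu.
apply: mulr_gt0; rewrite ?subr_gt0 lt_def ?mx; first by rewrite eq_sym tn0.
by case: pnu => ->.
Qed.

(** Concavity in the homogeneous form in which two weighted entropy terms are
    replaced by a single one; [w = 0] occurs at spaces inserted into a flag. *)
Lemma entropy_weighted_mix (w d : R) mu nu W : 0 <= w -> 0 < d ->
  is_probability mu -> is_probability nu ->
  w * entropy mu W + d * entropy nu W <= (w + d) * entropy (mix (w / (w + d)) mu nu) W.
Proof.
move=> w0 d0 pmu pnu; have wd : 0 < w + d by rewrite ltr_wpDl.
have t01 : 0 <= w / (w + d) <= 1.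
  by rewrite divr_ge0 ?(ltW wd) //= ler_pdivrMr // mul1r lerDl ltW.
have := entropy_concave W t01 pmu pnu.
rewrite -(ler_pM2l wd) mulrDr !mulrA; congr (_ * _ + _ * _ <= _).
  by field; rewrite gt_eqF.
by field; rewrite gt_eqF.
Qed.

Definition uniform_on (S : {fset 'rV[rat]_k}) : fsmeas R k :=
  [fsfun x in S => (#|` S|%:R)^-1].

Lemma uniform_on_prob S : S != fset0 -> is_probability (uniform_on S).
Proof.
rewrite -cardfs_gt0 => S0; split=> [x|].
  by rewrite fsfun_fun; case: ifP => // _; rewrite invr_ge0.
rewrite (big_fset_incl _ (finsupp_sub _ _ _ )) /=; last first.
  by move=> x _ xn; rewrite fsfun_dflt.
rewrite big_seq (eq_bigr (fun=> (#|` S|%:R)^-1)); last first.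
  by move=> x xS; rewrite fsfun_fun xS.
rewrite -big_seq big_const_seq count_predT iter_addr_0 -[LHS]mulr_natr mulVf //.
by rewrite pnatr_eq0 -lt0n.
Qed.

Lemma entropy_uniform_on S W : S != fset0 ->
  {in S &, forall x y, x - y \in W -> x = y} ->
  entropy (uniform_on S) W = ln #|` S|%:R.
Proof.
move=> S0 sep.
have sub : finsupp (uniform_on S) `<=` S by exact: finsupp_sub.
have card0 : (0 : R) < #|` S|%:R by rewrite ltr0n cardfs_gt0.
have cm x : x \in S -> coset_mass (uniform_on S) W x = (#|` S|%:R)^-1.
  move=> xS; rewrite (coset_massE _ _ sub) (big_fsetD1 x) //= subrr mem0v.
  rewrite big_seq big1 ?addr0 ?mulr1 ?fsfun_fun ?xS // => y.
  rewrite !inE => /andP[yx yS]; case: (boolP (_ \in W)); rewrite ?mulr0 //.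
  by move/(sep _ _ yS xS)/eqP; rewrite (negPf yx).
rewrite (entropyE _ sub) big_seq.
under eq_bigr => x xS do rewrite cm // lnV ?posrE // mulrN.
rewrite -big_seq sumrN opprK -mulr_suml.
by rewrite (sum_prob (uniform_on_prob S0)) ?mul1r.
Qed.

(** [ln (5/6) <= - 1/6], and [1/3 < (5/6)^6]. *)
Lemma ln3_gt1 : 1 < ln (3 : R).
Proof.
have l : ln (1 + - 6^-1 : R) <= - 6^-1 by apply: le_ln1Dx; lra.
have p : (0 : R) < 1 + - 6^-1 by lra.
have : ln (3^-1 : R) < ln ((1 + - 6^-1) ^+ 6).
  rewrite ltr_ln ?posrE ?exprn_gt0 ?invr_gt0 //.
  by rewrite !exprS expr0; lra.
rewrite lnXn // lnV ?posrE //; lra.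
Qed.

Lemma cube_outside W V : proper_subv W V -> cube_spanned V ->
  exists x, [/\ is_cube x, x \in V & x \notin W].
Proof.
move=> /andP[WV WneV] [s cs sV].
have [x xs xW] : exists2 x, x \in s & x \notin W.
  apply/hasP; rewrite has_predC; apply: contra WneV => /allP sW.
  by rewrite eqEsubv WV -sV; apply/span_subvP.
by exists x; split=> //; [exact: (allP cs)|rewrite -sV memv_span].
Qed.

(** With [x] a cube point of [V] outside [W], the cube points [0], [x] and
    [1 - x] are pairwise incongruent modulo [W]: their differences are [x],
    [1 - x] and [2x - 1] up to sign, and [1] lies in [W]. *)
Lemma ternary_measure W V : const_mx 1 \in W -> proper_subv W V -> cube_spanned V ->
  exists nu, [/\ is_probability nu, supported_on_cube nu V & entropy nu W = ln 3].
Proof.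
move=> oneW WltV sV.
have [x [cx xV xW]] := cube_outside WltV sV; have /andP[WV _] := WltV.
pose one : 'rV[rat]_k := const_mx 1.
(* If [2x - 1] were in [W], then so would be [x], half of [(2x - 1) + 1]. *)
have dbl : x - (one - x) \notin W.
  apply: contra xW; rewrite opprB addrA => /(memvD oneW); rewrite addrCA subrr addr0.
  by rewrite -mulr2n -scaler_nat rpredZeq pnatr_eq0.
have oV : one \in V by rewrite (subvP WV).
pose S := [fset 0; x; one - x].
have S0 : S != fset0 by apply/fset0Pn; exists x; rewrite !inE eqxx orbT.
have c3 : #|` S| = 3.
  have xx : x != 0 by apply: contraNneq xW => ->; rewrite mem0v.
  have ox : one != x by apply: contraNneq xW => <-.
  have xox : x != one - x by rewrite -subr_eq0; apply: contraNneq dbl => ->; rewrite mem0v.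
  rewrite /S fsetUC cardfsU1 cardfs2 !inE !negb_or.
  by rewrite subr_eq0 ox [_ - _ == x]eq_sym xox eq_sym xx.
exists (uniform_on S); split.
- exact: uniform_on_prob.
- move=> y; rewrite fsfun_fun !inE; case: ifP; rewrite ?eqxx // => + _.
  have c0 : @is_cube k 0 by apply/forallP => i; rewrite mxE eqxx.
  move=> /orP[/orP[]|] /eqP ->; rewrite ?mem0v ?xV ?c0 ?cx ?memvB //; split=> //.
  apply/forallP => i; rewrite !mxE; have /orP[] := forallP cx i => /eqP ->.
    by rewrite subr0 eqxx orbT.
  by rewrite subrr eqxx.
- have oxW : one - x \notin W by rewrite rpredBl.
  rewrite entropy_uniform_on // ?c3 // => y z.
  rewrite !inE => /orP[/orP[]|] /eqP -> /orP[/orP[]|] /eqP -> //;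
    rewrite ?subr0 ?sub0r ?rpredN ?(negPf xW) ?(negPf oxW) ?(negPf dbl) //.
  by rewrite -opprB rpredN (negPf dbl).
Qed.

End Entropy.

(** * The entropy functional along a flag *)

Section Flags.
Variables (R : realType) (k : nat).
Implicit Types (V W : nat -> {vspace 'rV[rat]_k}) (c : nat -> R) (mu : nat -> fsmeas R k).

Lemma flag_subv r V i j : is_flag r V -> (i <= j <= r)%N -> (V i <= V j)%VS.
Proof.
move=> [_ fl] /andP[]; elim: j => [|j IH]; first by rewrite leqn0 => /eqP ->.
rewrite leq_eqVlt => /predU1P[-> //|]; rewrite ltnS => ij jr.
apply: subv_trans (IH ij (ltnW jr)) _.
by have /andP[] := fl j.+1 jr.
Qed.

Lemma flag_dim r V j : is_flag r V -> (j <= r)%N -> (j <= \dim (V j))%N.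
Proof.
move=> [_ fl]; elim: j => // j IH jr; apply: leq_ltn_trans (IH (ltnW jr)) _.
have /andP[sub ne] := fl j.+1 jr.
by rewrite ltn_neqAle (dimvS sub) andbT (dimv_leqif_eq sub).
Qed.

(** Summation by parts: the second sum in [evalue] is rewritten so that each
    space occurs once, with the same weight as its entropy. *)
Lemma evalueE r V c mu : (forall j, (1 <= j <= r)%N -> (V j.-1 <= V j)%VS) ->
  evalue r V c mu =
  \sum_(1 <= j < r.+1) (c j - c j.+1) * (entropy (mu j) (V j) + (\dim (V j))%:R)
  + c r.+1 * (\dim (V r))%:R - c 1%N * (\dim (V 0%N))%:R.
Proof.
rewrite /evalue; elim: r => [|r IH] sub; first by rewrite !big_geq // !add0r subrr.
have sub' j : (1 <= j <= r)%N -> (V j.-1 <= V j)%VS.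
  by move=> /andP[j1 /leqW jr]; apply: sub; rewrite j1.
have := IH sub'; rewrite !(big_nat_recr r.+1) //= /codimv.
by rewrite natrB ?dimvS ?(sub r.+1) ?leqnn //=; lra.
Qed.

Lemma subflag_self r V : is_flag r V -> subflag r V V.
Proof.
move=> fl; split=> //; first by case: fl.
by move=> j /andP[j0 jr]; apply: flag_subv fl _; rewrite leq_pred.
Qed.

(** The entropies of the full flag vanish because [mu j] lives on [V j], so only
    the entropies and the codimensions of the subflag remain. *)
Lemma evalueB r V W c mu : is_flag r V -> subflag r W V ->
  (forall j, (1 <= j <= r)%N -> is_probability (mu j) /\ supported_on_cube (mu j) (V j)) ->
  evalue r W c mu - evalue r V c mu =
  \sum_(1 <= j < r.+1) (c j - c j.+1) * (entropy (mu j) (W j) - ((\dim (V j))%:R - (\dim (W j))%:R))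
  - c r.+1 * ((\dim (V r))%:R - (\dim (W r))%:R).
Proof.
move=> fl [W0 Wm WV] pmu; have [V0 _] := fl; have [_ Vm _] := subflag_self fl.
rewrite !evalueE // W0 V0.
set A := (X in X + _ - _ - _); set B := (X in _ - (X + _ - _)).
set C := (X in _ = X - _); have -> : C = A - B; last by ring.
rewrite /A /B /C -sumrB !big_nat; apply: eq_bigr => j jr; have [pj sj] := pmu j jr.
rewrite (entropy_eq0 (W := V j)) //; last by move=> x /sj[].
by ring.
Qed.

(** * Refining a flag *)

(** The inserted value becomes the [i]-th one; the former [i]-th value is shifted
    to position [i.+1]. *)
Definition insert_at T (i : nat) (a : T) (f : nat -> T) (j : nat) : T :=
  if (j < i)%N then f j else if j == i then a else f j.-1.

Lemma insert_at_lt T i (a : T) f j : (j < i)%N -> insert_at i a f j = f j.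
Proof. by rewrite /insert_at => ->. Qed.

Lemma insert_at_eq T i (a : T) f : insert_at i a f i = a.
Proof. by rewrite /insert_at ltnn eqxx. Qed.

Lemma insert_at_gt T i (a : T) f j : (i <= j)%N -> insert_at i a f j.+1 = f j.
Proof. by move=> ij; rewrite /insert_at ltnNge leqW //= gtn_eqF. Qed.

(** Inserting [c i] at position [i] makes the [i]-th and [i.+1]-st thresholds
    equal, so the [i]-th space and measure get weight zero. *)
Lemma evalue_insert r V W c mu i nu : (1 <= i <= r)%N ->
  (forall j, (1 <= j <= r.+1)%N -> (W j.-1 <= W j)%VS) ->
  (forall j, (j < i)%N -> W j = V j) -> (forall j, (i <= j)%N -> W j.+1 = V j) ->
  evalue r.+1 W (insert_at i (c i) c) (insert_at i nu mu) = evalue r V c mu.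
Proof.
move=> /andP[i0 ilr] Wm Wlt Wgt; rewrite !evalueE //; last first.
  move=> j /andP[j0 jr]; have [ji|ij|->] := ltngtP j i.
  - rewrite -(Wlt j) // -(Wlt j.-1) ?(leq_ltn_trans (leq_pred _)) //.
    by apply: Wm; rewrite j0 leqW.
  - case: j ij jr {j0} => // j ij jr; rewrite -(Wgt j) // -Wgt ?(ltnW ij) //.
    exact: (Wm j.+2).
  rewrite -(Wgt i) // -(Wlt i.-1) ?ltn_predL //.
  by apply: subv_trans (Wm i _) (Wm i.+1 _); lia.
rewrite [in LHS]insert_at_gt 1?leqW // (Wgt r) // (Wlt 0%N) //.
have -> : insert_at i (c i) c 1%N = c 1%N.
  have [i1|i1|<-] := ltngtP 1%N i; by [rewrite insert_at_lt|rewrite insert_at_eq|lia].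
congr (_ + _ - _).
rewrite (big_cat_nat (n := i)) ?(leqW (leqW ilr)) ?(leqW ilr) //=.
rewrite [RHS](big_cat_nat (n := i)) ?(leqW ilr) //=.
congr (_ + _).
  apply: eq_big_nat => j /andP[j0 ji]; rewrite !(insert_at_lt _ _ ji) // Wlt //.
  congr ((_ - _) * _); have [ji'|ji'|ji'] := ltngtP j.+1 i.
  - by rewrite insert_at_lt.
  - by lia.
  - by rewrite ji' insert_at_eq.
rewrite big_ltn 1?ltnW // insert_at_eq insert_at_gt // subrr mul0r add0r.
rewrite big_add1 /=; apply: eq_big_nat => j /andP[ij jr].
by rewrite !insert_at_gt ?leqW // Wgt.
Qed.

(** The new space is [V i.-1 + <[x]>] for a cube point [x] of [V i] outside
    [V i.-1]. Dropping the [i]-th space of a subflag of the refined flag gives a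
    subflag of the original one with the same value of [e], which is how the
    entropy condition is inherited. *)
Lemma refinement_step r V c mu i : entropy_system r V c mu -> entropy_condition r V c mu ->
  (1 <= i <= r)%N -> codimv (V i) (V i.-1) != 1%N ->
  exists U nu, entropy_system r.+1 (insert_at i U V) (insert_at i (c i) c) (insert_at i nu mu) /\
    entropy_condition r.+1 (insert_at i U V) (insert_at i (c i) c) (insert_at i nu mu).
Proof.
move=> [[fl sp] nd [c1 cm cl] pmu] ec ir cd.
have /andP[i0 ilr] := ir; have [V0 Vp] := fl.
have [x [cx xV xU]] := cube_outside (Vp i ir) (sp _ ilr).
pose U := (V i.-1 + <[x]>)%VS.
have subU : (V i.-1 <= U)%VS by exact: addvSl.
have subUV : (U <= V i)%VS.
  by rewrite subv_add -memvE xV andbT; case/andP: (Vp i ir).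
have pU : proper_subv (V i.-1) U.
  rewrite /proper_subv subU /=; apply: contraNneq xU => ->.
  by rewrite memvE addvSr.
(* Equality would make the step from [V i.-1] to [V i] one-dimensional. *)
have pUV : proper_subv U (V i).
  rewrite /proper_subv subUV /=; apply: contra_neq cd => UV.
  have := dimv_add_leqif (V i.-1) <[x]>; rewrite -/U UV dim_vline => -[le _].
  have /andP[s ne] := Vp i ir.
  have : (\dim (V i.-1) < \dim (V i))%N.
    by rewrite ltn_neqAle (dimvS s) andbT (dimv_leqif_eq s).
  by rewrite /codimv; move: le; case: (x == 0); lia.
have spU : cube_spanned U.
  have [s cs ss] := sp i.-1 (leq_trans (leq_pred _) ilr).
  exists (rcons s x); first by rewrite all_rcons cx.
  by rewrite -cats1 span_cat ss span_seq1.
have oneU j : (j <= r)%N -> const_mx 1 \in V j.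
  by move=> jr; apply: subvP (flag_subv (i := 0%N) fl _) _ _; rewrite ?V0 ?memv_line.
have [nu [pnu snu _]] := ternary_measure R (oneU i.-1 (leq_trans (leq_pred _) ilr)) pU spU.
exists U, nu.
have flW : is_flag r.+1 (insert_at i U V).
  split=> [|[|j] // /andP[_ jr]]; first by rewrite insert_at_lt.
  rewrite /=; have [ji|ij|ji] := ltngtP j.+1 i.
  - rewrite (insert_at_lt _ _ ji) (insert_at_lt _ _ (ltnW ji)); apply: (Vp j.+1); lia.
  - rewrite ltnS in ij; rewrite (insert_at_gt _ _ ij).
    case: j ij jr => [|j] ij jr; first by lia.
    have [lt|gt|eq] := ltngtP i j.+1; first 1 last.
    - by lia.
    - by rewrite -eq insert_at_eq.
    by rewrite insert_at_gt //; apply: (Vp j.+1).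
  - by rewrite ji insert_at_eq insert_at_lt; move: pU; rewrite -ji.
split.
  split.
  - split=> // j jr; have [ji|ij|->] := ltngtP j i.
    + by rewrite insert_at_lt //; apply: sp; lia.
    + case: j ij jr => // j ij jr; rewrite insert_at_gt //; exact: sp.
    + by rewrite insert_at_eq.
  - by rewrite insert_at_gt.
  - split.
    + have [i1|i1|<-] := ltngtP 1%N i; by [rewrite insert_at_lt|rewrite insert_at_eq|lia].
    + move=> j /andP[j1 jr]; have [ji|ij|->] := ltngtP j i.
      * rewrite (insert_at_lt _ _ ji); have [ji'|ji'|ji'] := ltngtP j.+1 i.
        - by rewrite insert_at_lt //; apply: cm; lia.
        - by lia.
        - by rewrite ji' insert_at_eq -ji'; apply: cm; lia.
      * case: j ij jr j1 => // j ij jr _; rewrite !insert_at_gt ?(ltnW ij) //; apply: cm; lia.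
      * by rewrite insert_at_eq insert_at_gt.
    + by rewrite insert_at_gt // leqW.
  - move=> j /andP[j1 jr]; have [ji|ij|->] := ltngtP j i.
    + by rewrite !insert_at_lt //; apply: pmu; lia.
    + case: j ij jr j1 => // j ij jr _; rewrite !insert_at_gt //; apply: pmu; lia.
    + by rewrite !insert_at_eq.
move=> W [W0 Wm WV].
have [_ Im _] := subflag_self flW.
rewrite [leLHS](evalue_insert (V := V)) //; last 2 first.
- by move=> j; exact: insert_at_lt.
- by move=> j; exact: insert_at_gt.
(* The subflag of [V] left after dropping the [i]-th space of [W]. *)
pose W' j := if (j < i)%N then W j else W j.+1.
rewrite [leRHS](evalue_insert (V := W')) //; last 2 first.
- by move=> j ji; rewrite /W' ji.
- by move=> j ij; rewrite /W' ltnNge ij.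
apply: ec; split; first by rewrite /W' i0.
- move=> j /andP[j1 jr]; rewrite /W'; have [ji|ij|->] := ltngtP j i.
  + by rewrite (leq_ltn_trans (leq_pred _) ji); apply: Wm; lia.
  + have -> : (j.-1 < i)%N = false by lia.
    by rewrite prednK //; apply: (Wm j.+1); lia.
  + rewrite ltn_predL i0; apply: subv_trans (Wm i _) (Wm i.+1 _); lia.
- move=> j jr; rewrite /W'; case: ltnP => ij.
    by rewrite -(insert_at_lt U V ij); apply: WV; lia.
  by rewrite -(insert_at_gt U V ij); apply: WV.
Qed.

(** Dimensions increase strictly along a flag, so [r <= dim (V r)] throughout;
    each refinement step fixes [V r] and increases [r], hence the process ends. *)
Lemma complete_refinement r V c mu : entropy_system r V c mu -> entropy_condition r V c mu ->
  exists h W c' mu',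
    [/\ complete_flag h W, W h = V r &
        forall i, (i <= r)%N -> exists2 j, (j <= h)%N & W j = V i] /\
    [/\ entropy_system h W c' mu', entropy_condition h W c' mu',
        c' 1%N = c 1%N & c' h.+1 = c r.+1].
Proof.
have [n] := ubnP (\dim (V r) - r); elim: n => // n IH in r V c mu *.
move=> len sys ec; have [[fl _] _ _ _] := sys.
have [/forallP all1|] := boolP [forall j : 'I_r, codimv (V j.+1) (V j) == 1%N].
  exists r, V, c, mu; do ?split=> //.
    by case=> // j jr; exact/eqP/(all1 (Ordinal jr)).
  by move=> i ir; exists i.
rewrite negb_forall => /existsP[i cd].
have [U [nu [sys' ec']]] := refinement_step (i := i.+1) sys ec (ltn_ord i) cd.
have [[fl' _] _ _ _] := sys'.
have ir : (i < r)%N := ltn_ord i.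
have dW := flag_dim fl' (leqnn _).
have lt : (\dim (insert_at i.+1 U V r.+1) - r.+1 < n)%N.
  by move: dW len; rewrite insert_at_gt //; lia.
have [h [W [c' [mu' [[cW Wh WV] [sW eW c1 cl]]]]]] := IH _ _ _ _ lt sys' ec'.
exists h, W, c', mu'; do ?split=> //.
- by rewrite Wh insert_at_gt.
- move=> j jr; have [ji|ij] := ltnP j i.+1.
    by rewrite -(insert_at_lt U V ji); apply: WV; exact: leqW.
  by rewrite -(insert_at_gt U V ij); apply: WV.
- rewrite c1 /insert_at; case: ifP => //; case: eqP => [<-//|]; lia.
- by rewrite cl insert_at_gt // leqW.
Qed.

(** * Perturbing to strict inequalities *)

(** With ratio [q = a / (a + m)] one has [a q^j - m q^(j+1) = a q^(j+1)], so by
    induction a first term at least [a q^i], followed by terms at least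
    [- m q^j], keeps every partial sum at or above [a q^j]. *)
Lemma geometric_dominance (a m : R) (F : nat -> R) r i : 0 < a -> 0 <= m ->
  (1 <= i <= r)%N -> (forall j, (1 <= j < i)%N -> 0 <= F j) -> a <= F i ->
  (forall j, (i < j <= r)%N -> - m <= F j) ->
  0 < \sum_(1 <= j < r.+1) (a / (a + m)) ^+ j * F j.
Proof.
move=> a0 m0 /andP[i1 ir] Flt Fi Fgt; set q := a / (a + m).
have am : 0 < a + m by rewrite ltr_pwDl.
have q0 : 0 < q by rewrite divr_gt0.
have aq : a = (a + m) * q by rewrite /q mulrC divfK ?gt_eqF.
suff: a * q ^+ r <= \sum_(1 <= j < r.+1) q ^+ j * F j.
  by apply: lt_le_trans; rewrite mulr_gt0 ?exprn_gt0.
elim: r ir Fgt => [|r IH]; first by lia.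
rewrite leq_eqVlt => /predU1P[<- _|ir Fgt].
  rewrite big_nat_recr //= mulrC; apply: ler_wpDl; last first.
    by rewrite ler_wpM2l // exprn_ge0 // ltW.
  rewrite big_nat; apply: sumr_ge0 => j ji.
  by rewrite mulr_ge0 ?Flt // exprn_ge0 // ltW.
rewrite big_nat_recr //=.
have H1 : a * q ^+ r <= \sum_(1 <= j < r.+1) q ^+ j * F j.
  by apply: IH => // j /andP[ij jr]; apply: Fgt; rewrite ij leqW.
have H2 : q ^+ r.+1 * - m <= q ^+ r.+1 * F r.+1.
  by rewrite ler_wpM2l ?exprn_ge0 ?(ltW q0) // Fgt // leqnn andbT.
have H3 : a * q ^+ r = (a + m) * q ^+ r.+1 by rewrite exprS mulrA -aq.
by lra.
Qed.

(** The increments [d j] of the weights are proportional to the [q ^+ j] of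
    [geometric_dominance] and sum to [c r.+1 - cstar], which keeps the first
    threshold unchanged. *)
Lemma strict_perturbation r V c mu (cstar : R) : complete_flag r V ->
  entropy_system r V c mu -> entropy_condition r V c mu -> (0 < r)%N ->
  0 < cstar < c r.+1 ->
  exists c' mu', [/\ entropy_system r V c' mu', strict_entropy_condition r V c' mu',
    c' 1%N = c 1%N & c' r.+1 = cstar].
Proof.
move=> [fl cd] [[_ sp] nd [c1 cm cl] pmu] ec r0 /andP[b0 bc].
have [V0 Vp] := fl.
have dimV j : (1 <= j <= r)%N -> \dim (V j) = (\dim (V j.-1)).+1.
  move=> jr; have /andP[/dimvS le _] := Vp j jr.
  by have := cd j jr; rewrite /codimv; lia.
have oneV j : (j <= r)%N -> const_mx 1 \in V j.
  by move=> jr; apply: subvP (flag_subv (i := 0%N) fl _) _ _; rewrite ?V0 ?memv_line.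
have /choice[nu Hnu] : forall j, exists nu : fsmeas R k, (1 <= j <= r)%N ->
    [/\ is_probability nu, supported_on_cube nu (V j)
      & entropy nu (V j.-1) = ln 3].
  move=> j; have [jr|_] := boolP (1 <= j <= r)%N; last by exists (uniform_on R fset0).
  have /andP[_ jr'] := jr; have j1r := leq_trans (leq_pred j) jr'.
  have [nu Hnu] := ternary_measure R (oneV _ j1r) (Vp j jr) (sp _ jr').
  by exists nu.
(* [a] bounds below the gain at the first index where a subflag departs from
   [V], and [m] bounds above the loss at any later index. *)
pose a : R := ln 3 - 1; have a0 : 0 < a by rewrite subr_gt0 ln3_gt1.
pose m : R := (\dim (V r))%:R; have m0 : 0 <= m by rewrite ler0n.
pose q := a / (a + m).
have q0 : 0 < q by rewrite divr_gt0 // ltr_pwDl.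
pose T := \sum_(1 <= j < r.+1) q ^+ j.
have T0 : 0 < T.
  rewrite /T big_ltn // ltr_pwDl ?exprn_gt0 //.
  by apply: sumr_ge0 => j _; rewrite exprn_ge0 ?ltW.
pose K := (c r.+1 - cstar) / T; have K0 : 0 < K by rewrite divr_gt0 ?subr_gt0.
pose d j := K * q ^+ j; have d0 j : 0 < d j by rewrite mulr_gt0 ?exprn_gt0.
pose w j := c j - c j.+1.
have w0 j : (1 <= j <= r)%N -> 0 <= w j by move=> jr; rewrite subr_ge0 cm.
(* Solves [c' j - c' j.+1 = w j + d j] with the prescribed last value. *)
pose c' j := c j - (c r.+1 - cstar) + \sum_(j <= i < r.+1) d i.
have c'B j : (1 <= j <= r)%N -> c' j - c' j.+1 = w j + d j.
  by move=> /andP[_ jr]; rewrite /c' big_ltn // /w; ring.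
have c'r : c' r.+1 = cstar by rewrite /c' big_geq //; ring.
have c'1 : c' 1%N = c 1%N.
  rewrite /c' -mulr_sumr -/T /K divfK ?gt_eqF //; ring.
pose mu' j := mix (w j / (w j + d j)) (mu j) (nu j).
have t01 j : (1 <= j <= r)%N -> 0 <= w j / (w j + d j) <= 1.
  move=> jr; have wd : 0 < w j + d j by rewrite ltr_wpDl ?w0.
  by rewrite divr_ge0 ?w0 ?(ltW wd) //= ler_pdivrMr // mul1r lerDl ltW.
have pmu' j : (1 <= j <= r)%N -> is_probability (mu' j) /\ supported_on_cube (mu' j) (V j).
  move=> jr; have [pm sm] := pmu j jr; have [pn sn _] := Hnu j jr.
  by split; [apply: mix_prob => //; exact: t01|apply: mix_supported].
exists c', mu'; split=> //.
  split=> //; split; rewrite ?c'1 ?c'r ?(ltW b0) //.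
  by move=> j jr; rewrite -subr_ge0 c'B // addr_ge0 ?w0 // ltW.
move=> W [sW [i0 i0r Wi0]].
have [W0 Wm WV] := sW.
have := ec W sW; rewrite -subr_ge0 -[in X in _ -> X]subr_gt0 !evalueB //.
pose D j : R := (\dim (V j))%:R - (\dim (W j))%:R.
have Dr : 0 <= D r by rewrite subr_ge0 ler_nat dimvS ?WV.
pose F j := entropy (nu j) (W j) - D j.
rewrite c'r -!/(D _) => ec0.
have dF : 0 < \sum_(1 <= j < r.+1) d j * F j.
  rewrite (eq_bigr (fun j => K * (q ^+ j * F j))); last by move=> j _; rewrite mulrA.
  rewrite -mulr_sumr mulr_gt0 //.
  have exi : exists i, (1 <= i <= r)%N && (W i != V i).
    by exists i0; rewrite i0r; case/andP: Wi0.
  case: (ex_minnP exi) => i /andP[ir WVi] imin; have /andP[i1 ilr] := ir.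
  have eqW j : (j < i)%N -> W j = V j.
    case: j => [|j] ji; first by rewrite W0 V0.
    have jr : (j.+1 <= r)%N by rewrite (leq_trans (ltnW ji)).
    apply/eqP; apply: contraLR ji => ne; rewrite -leqNgt; apply: imin.
    by rewrite ne jr.
  (* [V i.-1 = W i.-1 <= W i < V i], and the outer step has dimension one. *)
  have Wi : W i = V i.-1.
    apply/eqP; rewrite eq_sym eqEdim -(eqW i.-1) ?ltn_predL // Wm //=.
    rewrite (eqW i.-1) ?ltn_predL // -ltnS.
    by rewrite -dimV // ltn_neqAle dimvS ?WV // andbT (dimv_leqif_eq (WV i ilr)).
  have [pn sn Hn] := Hnu i ir.
  apply: (geometric_dominance (i := i)) => //.
  - move=> j /andP[j1 ji]; rewrite /F /D eqW // subrr subr0.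
    by apply: entropy_ge0; have [] := Hnu j; rewrite ?j1 ?(leq_trans (ltnW ji)).
  - by rewrite /F /D Wi Hn dimV // lerD2l lerN2 -natrB // subSnn.
  - move=> j /andP[ij jr]; have jr' : (1 <= j <= r)%N by rewrite jr andbT (leq_trans i1 (ltnW ij)).
    have [pnj _ _] := Hnu j jr'; have := entropy_ge0 (W j) pnj.
    have : (\dim (V j))%:R <= m by rewrite ler_nat dimvS // (flag_subv fl) // jr leqnn.
    have : 0 <= (\dim (W j))%:R :> R by [].
    by rewrite /F /D; lra.
have le : \sum_(1 <= j < r.+1) (w j * (entropy (mu j) (W j) - D j) + d j * F j) <=
  \sum_(1 <= j < r.+1) (c' j - c' j.+1) * (entropy (mu' j) (W j) - D j).
  rewrite !big_nat; apply: ler_sum => j jr; rewrite c'B //.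
  have [pm _] := pmu j jr; have [pn _ _] := Hnu j jr.
  have := entropy_weighted_mix (W j) (w0 j jr) (d0 j) pm pn.
  by rewrite -/(mu' j) /F; lra.
rewrite big_split /= in le.
have : cstar * D r <= c r.+1 * D r by rewrite ler_wpM2r // ltW.
by lra.
Qed.

End Flags.

Unset Implicit Arguments.

(** * Complete flags with the strict entropy condition *)

Theorem theorem3p4 (R : realType) (k : nat) (hk : (2 <= k)%N) (r : nat)
    (V : nat -> {vspace 'rV[rat]_k}) (c : nat -> R) (mu : nat -> fsmeas R k)
    (hsys : entropy_system r V c mu)
    (hent : entropy_condition r V c mu)
    (hc1 : c 1%N = 1)
    (hb : 0 < c r.+1)
    (cstar : R) (hcstar : 0 < cstar < c r.+1) :
  exists (h : nat) (W : nat -> {vspace 'rV[rat]_k}) (c' : nat -> R)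
         (mu' : nat -> fsmeas R k),
    [/\ complete_flag h W, W 0%N = V 0%N & W h = V r] /\
    (forall i, (i <= r)%N -> exists2 j, (j <= h)%N & W j = V i) /\
    threshold_sequence h c' /\
    (forall j, (1 <= j <= h)%N -> is_probability (mu' j)) /\
    c' 1%N = 1 /\ c' h.+1 = cstar /\
    entropy_system h W c' mu' /\
    strict_entropy_condition h W c' mu'.
Proof.
have [h [W [c1 [mu1 [[cW Wh WV] [sys1 ec1 c11 c1l]]]]]] := complete_refinement hsys hent.
have [[[V0 _] _] _ _ _] := hsys; have [[W0 _] _] := cW.
(* For [h = 0] the top space would be the line of constant vectors, which is
   degenerate since [2 <= k]. *)
have h0 : (0 < h)%N.
  rewrite lt0n; apply/eqP => h0; have [_ nd _ _] := sys1.
  have [x] := nd (Ordinal (ltnW hk)) (Ordinal hk) isT.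
  by rewrite h0 W0 => /vlineP[t ->]; rewrite !mxE eqxx.
rewrite -c1l in hcstar.
have [c' [mu' [sys' ec' c'1 c'l]]] := strict_perturbation cW sys1 ec1 h0 hcstar.
exists h, W, c', mu'; have [_ _ thr pm] := sys'.
split; first by rewrite W0 V0.
do 2![split=> //]; split; first by move=> j /pm[].
by rewrite c'1 c11.
Qed.
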